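(* Let $d\geq3$ and let $x_1,\dots,x_{d-1}$ be real numbers with $0<x_i<1$ for all $i$ and $x_i\neq x_j$ for at least one pair $(i,j)$. Let $\Omega$ be the quantum channel on $d\times d$ matrices with Kraus operators $A_0=\mathrm{diag}(1,x_1,\dots,x_{d-1})$ and, for $m=1,\dots,d-1$, $(A_m)_{ij}=\sqrt{1-x_m^2}\,\delta_{0i}\delta_{mj}$ ($i,j=0,\dots,d-1$). Then there is a pure state $|\psi'\rangle\in\mathbb{C}^d\otimes\mathbb{C}^d$ which is not maximally entangled such that for every maximally entangled state $|\Phi\rangle\in\mathbb{C}^d\otimes\mathbb{C}^d$, $$\mathbb{F}(\Omega)\geq\mathbb{F}(\rho_{\psi',\Omega})>\mathbb{F}^*(\rho_{\Phi,\Omega}).$$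
   Context: For a pure state $|\psi\rangle\in\mathbb{C}^d\otimes\mathbb{C}^d$, $\rho_{\psi,\Omega}=(\mathcal{I}\otimes\Omega)(|\psi\rangle\langle\psi|)$ with $\Omega(X)=\sum_m A_mXA_m^\dagger$. The singlet fraction of a two-qudit state $\rho$ is $\mathbb{F}(\rho)=\max_{|\Phi\rangle}\langle\Phi|\rho|\Phi\rangle$ over all maximally entangled $|\Phi\rangle\in\mathbb{C}^d\otimes\mathbb{C}^d$. The maximum achievable singlet fraction is $\mathbb{F}^*(\rho)=\max_L\mathbb{F}(L(\rho))$ over all trace-preserving LOCC operations $L$. The one-shot optimal singlet fraction of the channel is $\mathbb{F}(\Omega)=\max_{|\psi\rangle}\mathbb{F}^*(\rho_{\psi,\Omega})$ over all pure states $|\psi\rangle\in\mathbb{C}^d\otimes\mathbb{C}^d$. *)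

(* Defs.v *)
From HB Require Import structures.
From mathcomp Require Import all_boot all_order all_algebra.
From mathcomp Require Import complex mxtens.
From mathcomp Require Import boolp classical_sets reals.
Set Implicit Arguments. Unset Strict Implicit. Unset Printing Implicit Defensive.
Import Order.TTheory GRing.Theory Num.Theory.
Local Open Scope ring_scope.
Local Open Scope classical_set_scope.

Section QInfo.
Variable R : realType.
Local Notation C := (R[i]).

Definition adj {m n} (A : 'M[C]_(m, n)) : 'M[C]_(n, m) := (map_mx (@conjc R) A)^T.

Definition kron {m n p q} (A : 'M[C]_(m, n)) (B : 'M[C]_(p, q)) : 'M[C]_(m * p, n * q) :=
  tensmx A B.

Definition kronv {m n} (u : 'cV[C]_m) (v : 'cV[C]_n) : 'cV[C]_(m * n) :=
  tensmx u v.

Definition unitary {n} (U : 'M[C]_n) : Prop := adj U *m U = 1%:M.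

Definition unit_vec {n} (v : 'cV[C]_n) : Prop := adj v *m v = 1%:M.

(* |Phi> is maximally entangled in C^d \otimes C^d: it has a Schmidt
   decomposition with all Schmidt coefficients equal to 1/sqrt d, i.e.
   |Phi> = sum_i (1/sqrt d) |e_i> \otimes |f_i> for orthonormal bases
   (e_i) = columns of a unitary U and (f_i) = columns of a unitary V. *)
Definition max_entangled (d : nat) (Phi : 'cV[C]_(d * d)) : Prop :=
  exists U V : 'M[C]_d, unitary U /\ unitary V /\
    Phi = \sum_(i < d) real_complex R ((Num.sqrt (d%:R : R))^-1) *: kronv (col i U) (col i V).

Definition apply_channel {n k} (A : 'I_k -> 'M[C]_n) (X : 'M[C]_n) : 'M[C]_n :=
  \sum_(m < k) A m *m X *m adj (A m).

Definition rho_out {d k} (A : 'I_k -> 'M[C]_d) (psi : 'cV[C]_(d * d)) : 'M[C]_(d * d) :=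
  \sum_(m < k) kron 1%:M (A m) *m (psi *m adj psi) *m adj (kron 1%:M (A m)).

(* <Phi| rho |Phi>, real part (it is real for Hermitian rho) *)
Definition overlap {n} (Phi : 'cV[C]_n) (rho : 'M[C]_n) : R :=
  @complex.Re R ((adj Phi *m rho *m Phi) 0 0).

Definition singlet_fraction (d : nat) (rho : 'M[C]_(d * d)) : R :=
  sup [set overlap Phi rho | Phi in [set Phi | max_entangled Phi]].

(* Finite-round LOCC protocols on a bipartite system whose local dimensions
   are currently (a, b), ending with local dimensions (d, d).  At each step one
   party performs a local instrument (outcomes 'I_n, each outcome one Kraus
   operator, possibly changing that party's local dimension) satisfying the
   completeness relation sum_k K_k^dagger K_k = 1; the outcome is broadcast
   and the rest of the protocol may depend on it. *)
Inductive locc (d : nat) : nat -> nat -> Type :=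
| LOCC_done : locc d d d
| LOCC_alice (a b a' n : nat) (K : 'I_n -> 'M[C]_(a', a)) :
    \sum_(k < n) adj (K k) *m K k = 1%:M ->
    ('I_n -> locc d a' b) -> locc d a b
| LOCC_bob (a b b' n : nat) (K : 'I_n -> 'M[C]_(b', b)) :
    \sum_(k < n) adj (K k) *m K k = 1%:M ->
    ('I_n -> locc d a b') -> locc d a b.

Fixpoint locc_apply (d a b : nat) (L : locc d a b) : 'M[C]_(a * b) -> 'M[C]_(d * d) :=
  match L in locc _ a b return 'M[C]_(a * b) -> 'M[C]_(d * d) with
  | LOCC_done => fun rho => rho
  | LOCC_alice a b a' n K _ next => fun rho =>
      \sum_(k < n) locc_apply (next k)
        (kron (K k) (1%:M : 'M[C]_b) *m rho *m adj (kron (K k) (1%:M : 'M[C]_b)))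
  | LOCC_bob a b b' n K _ next => fun rho =>
      \sum_(k < n) locc_apply (next k)
        (kron (1%:M : 'M[C]_a) (K k) *m rho *m adj (kron (1%:M : 'M[C]_a) (K k)))
  end.

Definition max_singlet_fraction (d : nat) (rho : 'M[C]_(d * d)) : R :=
  sup [set singlet_fraction (locc_apply L rho) | L in [set: locc d d d]].

Definition channel_singlet_fraction (d k : nat) (A : 'I_k -> 'M[C]_d) : R :=
  sup [set max_singlet_fraction (rho_out A psi) | psi in [set psi | unit_vec psi]].

Definition kraus_ops (d : nat) (x : nat -> R) (m : 'I_d) : 'M[C]_d :=
  if (m : nat) == 0%N then
    \matrix_(i < d, j < d) (if i == j then (if (i : nat) == 0%N then 1 else real_complex R (x i)) else 0)
  else
    \matrix_(i < d, j < d)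
      (if ((i : nat) == 0%N) && (j == m) then real_complex R (Num.sqrt (1 - x m ^+ 2)) else 0).

End QInfo.

(* Main.v *)
(* The partial transpose of [vecm M *m adj (vecm N)] is mapped by a product
   Kraus operator [A (x) B] to that of the pair [A M B^*], [A N B^*].  A local
   instrument thus preserves the total squared Frobenius norm, and a maximally
   entangled state overlaps such an operator by at most (|M|^2 + |N|^2) / 2d;
   by induction on the protocol the same bound holds after any LOCC.  Writing
   the output on a maximally entangled input through the eigenvectors of its
   partial transpose gives F* <= (d + S2 + S1^2) / d^2, where S1 and S2 are the
   sums of the x_i and of the x_i^2.  The input proportional to
   sum_i x_i |ii> (with x_0 = 1) reaches (1 + S2) / d, and the strict
   Cauchy-Schwarz inequality S1^2 < (d - 1) S2 separates the two. *)
Require Import Defs.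
From HB Require Import structures.
From mathcomp Require Import all_boot all_order all_algebra.
From mathcomp Require Import complex mxtens.
From mathcomp Require Import boolp classical_sets reals.
From mathcomp Require Import ring lra.
Import Order.TTheory GRing.Theory Num.Theory.
Local Open Scope ring_scope.
Set Implicit Arguments. Unset Strict Implicit. Unset Printing Implicit Defensive.

Section Bipartite.
Variable R : realType.
Local Notation C := (R[i]).
Local Notation rc := (real_complex R).

(** * Adjoints, real parts and the squared Frobenius norm *)

Lemma sum_mxtens (V : nmodType) m n (F : 'I_(m * n) -> V) :
  \sum_k F k = \sum_i \sum_j F (mxtens_index (i, j)).
Proof.
rewrite pair_big /=; apply: reindex => //=.
by exists (@mxtens_unindex m n) => -[i j] _; rewrite ?mxtens_indexK ?mxtens_unindexK //.
Qed.

Lemma adjE m n (A : 'M[C]_(m, n)) i j : adj A i j = conjc (A j i).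
Proof. by rewrite !mxE. Qed.

Lemma adjM m n p (A : 'M[C]_(m, n)) (B : 'M[C]_(n, p)) :
  adj (A *m B) = adj B *m adj A.
Proof. by rewrite /adj map_mxM trmx_mul. Qed.

Lemma adjK m n (A : 'M[C]_(m, n)) : adj (adj A) = A.
Proof. by apply/matrixP => i j; rewrite !mxE conjcK. Qed.

Lemma adjD m n (A B : 'M[C]_(m, n)) : adj (A + B) = adj A + adj B.
Proof. by rewrite /adj map_mxD linearD. Qed.

Lemma adj_sum m n I (r : seq I) (P : pred I) (F : I -> 'M[C]_(m, n)) :
  adj (\sum_(i <- r | P i) F i) = \sum_(i <- r | P i) adj (F i).
Proof.
by apply: (big_morph (@adj R m n) (@adjD m n)); rewrite /adj map_mx0 trmx0.
Qed.

Lemma adjZ m n (c : C) (A : 'M[C]_(m, n)) : adj (c *: A) = conjc c *: adj A.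
Proof. by rewrite /adj map_mxZ linearZ. Qed.

Lemma adj1 n : adj (1%:M : 'M[C]_n) = 1%:M.
Proof. by rewrite /adj map_mx1 trmx1. Qed.

Lemma adj_delta m n i j : adj (delta_mx i j : 'M[C]_(m, n)) = delta_mx j i.
Proof. by rewrite /adj map_delta_mx trmx_delta. Qed.

Lemma Re_sum I (r : seq I) (P : pred I) (F : I -> C) :
  complex.Re (\sum_(i <- r | P i) F i) = \sum_(i <- r | P i) complex.Re (F i).
Proof. exact: (big_morph (@complex.Re R) (fun x y => raddfD (@complex.Re R : Rcomplex R -> R) x y)). Qed.

Lemma ReZ (r : R) (z : C) : complex.Re (rc r * z) = r * complex.Re z.
Proof. by case: z => a b /=; rewrite mul0r subr0. Qed.

Definition frob2 m n (M : 'M[C]_(m, n)) : R := complex.Re (\tr (adj M *m M)).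

Lemma frob2E m n (M : 'M[C]_(m, n)) :
  frob2 M = \sum_i \sum_j (complex.Re (M i j) ^+ 2 + complex.Im (M i j) ^+ 2).
Proof.
rewrite /frob2 /mxtrace Re_sum exchange_big /=; apply: eq_bigr => i _.
rewrite mxE Re_sum; apply: eq_bigr => j _.
by rewrite !mxE; case: (M j i) => a b /=; ring.
Qed.

Lemma frob2Z m n (r : R) (M : 'M[C]_(m, n)) : frob2 (rc r *: M) = r ^+ 2 * frob2 M.
Proof.
by rewrite /frob2 adjZ conjc_real -scalemxAl -scalemxAr !mxtraceZ !ReZ mulrA.
Qed.

Lemma frob2_delta m n (i : 'I_m) (j : 'I_n) : frob2 (delta_mx i j) = 1.
Proof. rewrite /frob2 adj_delta mul_delta_mx /mxtrace (bigD1 j) //= mxE !eqxx big1 ?addr0 //.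
by move=> k /negPf kj; rewrite mxE kj. Qed.

(** Completeness collapses the sum inside the trace. In the partially transposed picture Alice's
    operators act from the left, and Bob's act from the right through their adjoints. *)
Lemma frob2_instrumentl k a b c (K : 'I_k -> 'M[C]_(c, a)) (M : 'M[C]_(a, b)) :
  \sum_i adj (K i) *m K i = 1%:M -> \sum_i frob2 (K i *m M) = frob2 M.
Proof.
move=> HK; rewrite /frob2 -Re_sum -raddf_sum; congr (complex.Re (\tr _)).
under eq_bigr => i _ do rewrite adjM mulmxA -(mulmxA (adj M)).
by rewrite -mulmx_suml -mulmx_sumr HK mulmx1.
Qed.

Lemma frob2_instrumentr k a b c (K : 'I_k -> 'M[C]_(c, b)) (M : 'M[C]_(a, b)) :
  \sum_i adj (K i) *m K i = 1%:M -> \sum_i frob2 (M *m adj (K i)) = frob2 M.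
Proof.
move=> HK; rewrite /frob2 -Re_sum; congr complex.Re.
under eq_bigr => i _ do
  rewrite adjM adjK mulmxA mxtrace_mulC !mulmxA -mulmxA.
by rewrite -raddf_sum /= -mulmx_suml HK mul1mx.
Qed.

(** * Vectorization of matrices and partial transposes *)

(** A bipartite vector is handled through its coefficient matrix, so that local operators become
    left and right multiplications. *)
Definition vecm m n (M : 'M[C]_(m, n)) : 'cV[C]_(m * n) :=
  \col_k M (mxtens_unindex k).1 (mxtens_unindex k).2.

Lemma vecmE m n (M : 'M[C]_(m, n)) i j l : vecm M (mxtens_index (i, j)) l = M i j.
Proof. by rewrite mxE mxtens_indexK. Qed.

Lemma vecm_surj m n (v : 'cV[C]_(m * n)) : exists M, v = vecm M.
Proof.
exists (\matrix_(i, j) v (mxtens_index (i, j)) 0).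
apply/matrixP => k l; rewrite ord1.
by case: (mxtens_indexP k) => i j; rewrite vecmE mxE.
Qed.

Lemma vecm_inj m n : injective (@vecm m n).
Proof. by move=> M N e; apply/matrixP => i j; rewrite -(vecmE M i j 0) e vecmE. Qed.

Lemma vecmZ m n c (M : 'M[C]_(m, n)) : vecm (c *: M) = c *: vecm M.
Proof. by apply/matrixP => i j; rewrite !mxE. Qed.

Lemma vecm_sum m n I (r : seq I) (P : pred I) (F : I -> 'M[C]_(m, n)) :
  vecm (\sum_(i <- r | P i) F i) = \sum_(i <- r | P i) vecm (F i).
Proof.
apply: (big_morph (@vecm m n)) => [A B|]; apply/matrixP => i j; by rewrite !mxE.
Qed.

Lemma vecm_dot m n (M N : 'M[C]_(m, n)) :
  (adj (vecm M) *m vecm N) 0 0 = \tr (adj M *m N).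
Proof.
rewrite mxE sum_mxtens exchange_big /=; apply: eq_bigr => j _.
rewrite mxE; apply: eq_bigr => i _.
by rewrite !mxE mxtens_indexK.
Qed.

Lemma kron_vecm m n p q (A : 'M[C]_(m, n)) (B : 'M[C]_(p, q)) (M : 'M[C]_(n, q)) :
  kron A B *m vecm M = vecm (A *m M *m B^T).
Proof.
apply/matrixP => r s; case: (mxtens_indexP r) => i j.
rewrite vecmE !mxE sum_mxtens exchange_big /=; apply: eq_bigr => l _.
rewrite !mxE mulr_suml; apply: eq_bigr => k _.
by rewrite /kron tensmxE vecmE mulrAC.
Qed.

(* The partial transpose, on the second factor, of the rank-one operator
   [vecm M *m adj (vecm N)]. *)
Definition ptens m n (M N : 'M[C]_(m, n)) : 'M[C]_(m * n) :=
  \matrix_(r, s) (M (mxtens_unindex r).1 (mxtens_unindex s).2 *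
                  conjc (N (mxtens_unindex s).1 (mxtens_unindex r).2)).

Lemma ptensE m n (M N : 'M[C]_(m, n)) i j k l :
  ptens M N (mxtens_index (i, j)) (mxtens_index (k, l)) = M i l * conjc (N k j).
Proof. by rewrite mxE !mxtens_indexK. Qed.

(** Moving the partial transpose past [B] replaces [B] by its complex conjugate, hence [adj B] on
    the right instead of [B^T]. Rank-one pairs stay rank-one pairs, so a protocol can be followed on
    [M] and [N] alone. *)
Lemma kron_ptens m n p q (A : 'M[C]_(m, n)) (B : 'M[C]_(p, q)) (M N : 'M[C]_(n, q)) :
  kron A B *m ptens M N *m adj (kron A B) =
  ptens (A *m M *m adj B) (A *m N *m adj B).
Proof.
apply/matrixP => r s.
case: (mxtens_indexP r) => i j; case: (mxtens_indexP s) => k l.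
(* The transposed indices cross: [v] ends up with [M] and [u] with [N], so the double sum
   factors. *)
have inner u v : (kron A B *m ptens M N) (mxtens_index (i, j)) (mxtens_index (u, v)) =
    (A *m M) i v * (B *m adj N) j u.
  rewrite !mxE big_distrlr sum_mxtens /=; apply: eq_bigr => t _; apply: eq_bigr => w _.
  by rewrite ptensE /kron tensmxE !mxE mulrACA.
have -> : ptens (A *m M *m adj B) (A *m N *m adj B) (mxtens_index (i, j))
    (mxtens_index (k, l)) = (A *m M *m adj B) i l * (B *m adj N *m adj A) j k.
  rewrite ptensE -adjE; congr (_ * _); congr (fun_of_matrix _ _ _).
  by rewrite !adjM adjK mulmxA.
rewrite mulrC mxE [(A *m M *m adj B) i l]mxE [(B *m adj N *m adj A) j k]mxE.
rewrite big_distrlr sum_mxtens /=; apply: eq_bigr => u _; apply: eq_bigr => v _.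
by rewrite inner !adjE /kron tensmxE rmorphM /=; ring.
Qed.

(** * Linearity of overlaps and of LOCC protocols *)

Lemma overlap_sum n (Phi : 'cV[C]_n) I (r : seq I) (P : pred I) (F : I -> 'M[C]_n) :
  overlap Phi (\sum_(i <- r | P i) F i) = \sum_(i <- r | P i) overlap Phi (F i).
Proof. by rewrite /overlap mulmx_sumr mulmx_suml summxE Re_sum. Qed.

Lemma overlapZ n (Phi : 'cV[C]_n) (r : R) (A : 'M[C]_n) :
  overlap Phi (rc r *: A) = r * overlap Phi A.
Proof. by rewrite /overlap -scalemxAr -scalemxAl mxE ReZ. Qed.

Lemma locc_apply_sum d a b (L : locc R d a b) I (r : seq I) (P : pred I)
    (F : I -> 'M[C]_(a * b)) :
  locc_apply L (\sum_(i <- r | P i) F i) = \sum_(i <- r | P i) locc_apply L (F i).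
Proof.
elim: L F => [|{}a {}b a' n K HK next IH|{}a {}b b' n K HK next IH] F //=.
  rewrite exchange_big /=; apply: eq_bigr => k _.
  by rewrite mulmx_sumr mulmx_suml IH.
rewrite exchange_big /=; apply: eq_bigr => k _.
by rewrite mulmx_sumr mulmx_suml IH.
Qed.

Lemma locc_applyZ d a b (L : locc R d a b) (c : C) (rho : 'M[C]_(a * b)) :
  locc_apply L (c *: rho) = c *: locc_apply L rho.
Proof.
elim: L rho => [|{}a {}b a' n K HK next IH|{}a {}b b' n K HK next IH] rho //=.
  by rewrite scaler_sumr; apply: eq_bigr => k _; rewrite -scalemxAr -scalemxAl IH.
by rewrite scaler_sumr; apply: eq_bigr => k _; rewrite -scalemxAr -scalemxAl IH.
Qed.

Lemma locc_overlap_sum d a b (L : locc R d a b) Phi I (r : seq I) (P : pred I)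
    (F : I -> 'M[C]_(a * b)) :
  overlap Phi (locc_apply L (\sum_(i <- r | P i) F i)) =
  \sum_(i <- r | P i) overlap Phi (locc_apply L (F i)).
Proof. by rewrite locc_apply_sum overlap_sum. Qed.

Lemma locc_overlapD d a b (L : locc R d a b) Phi (rho sigma : 'M[C]_(a * b)) :
  overlap Phi (locc_apply L (rho + sigma)) =
  overlap Phi (locc_apply L rho) + overlap Phi (locc_apply L sigma).
Proof.
have := locc_overlap_sum L Phi (index_enum bool) xpredT (fun b => if b then rho else sigma).
by rewrite !big_bool.
Qed.

Lemma locc_overlapZ d a b (L : locc R d a b) Phi r (rho : 'M[C]_(a * b)) :
  overlap Phi (locc_apply L (rc r *: rho)) = r * overlap Phi (locc_apply L rho).
Proof. by rewrite locc_applyZ overlapZ. Qed.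

(** * Maximally entangled states and the overlap bound under LOCC *)

Lemma unitaryC n (U : 'M[C]_n) : unitary U -> U *m adj U = 1%:M.
Proof. exact: mulmx1C. Qed.

(** The two Schmidt bases merge into the single unitary [U *m V^T]; conversely [W] is paired with
    the standard basis. *)
Lemma max_entangledP d (Phi : 'cV[C]_(d * d)) :
  max_entangled Phi <->
  exists2 W : 'M[C]_d, unitary W & Phi = rc (Num.sqrt d%:R)^-1 *: vecm W.
Proof.
have sumE (U V : 'M[C]_d) : \sum_(i < d) kronv (col i U) (col i V) = vecm (U *m V^T).
  apply/matrixP => r s; case: (mxtens_indexP r) => i j.
  rewrite vecmE summxE !mxE; apply: eq_bigr => k _.
  by rewrite !mxE mxtens_indexK.
split=> [[U [V [HU [HV ->]]]]|[W HW ->]].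
  exists (U *m V^T); last by rewrite -scaler_sumr sumE.
  rewrite /unitary adjM mulmxA -(mulmxA _ (adj U)) HU mulmx1.
  by rewrite /adj -trmx_mul -map_trmx -/(adj V) unitaryC ?trmx1.
exists W, 1%:M; split=> //; split; first by rewrite /unitary adj1 mulmx1.
by rewrite -scaler_sumr sumE trmx1 mulmx1.
Qed.

(** Entrywise, |Re(y conj z)| is at most (|y|^2 + |z|^2) / 2. The trace pairs [Y i j] with [Z j i],
    so the norm of [Z] is summed in transposed order. *)
Lemma Re_trace_conj_le n (Y Z : 'M[C]_n) :
  `|complex.Re (\tr (Y *m map_mx (@conjc R) Z))| <= (frob2 Y + frob2 Z) / 2.
Proof.
have -> : (frob2 Y + frob2 Z) / 2 = \sum_i \sum_j
   ((complex.Re (Y i j) ^+ 2 + complex.Im (Y i j) ^+ 2) +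
    (complex.Re (Z j i) ^+ 2 + complex.Im (Z j i) ^+ 2)) / 2.
  rewrite !frob2E [X in _ + X]exchange_big -big_split mulr_suml /=.
  by apply: eq_bigr => i _; rewrite -big_split mulr_suml.
rewrite Re_sum; apply: le_trans (ler_norm_sum _ _ _) _; apply: ler_sum => i _.
rewrite mxE Re_sum; apply: le_trans (ler_norm_sum _ _ _) _; apply: ler_sum => j _.
rewrite mxE; case: (Y i j) (Z j i) => [a b] [c e] /=.
have := (sqr_ge0 (a - c), sqr_ge0 (a + c), sqr_ge0 (b - e), sqr_ge0 (b + e)).
by rewrite ler_norml => -[[[h1 h2] h3] h4]; apply/andP; split; nra.
Qed.

(** Without the partial transpose this would be a product of two traces, which can be larger by a
    factor [d]. The transposition links the indices into one trace of a product. *)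
Lemma overlap_ptens d (W M N : 'M[C]_d) :
  overlap (vecm W) (ptens M N) =
  complex.Re (\tr (adj W *m M *m map_mx (@conjc R) (adj W *m N))).
Proof.
rewrite /overlap; congr complex.Re.
have e k l : (adj (vecm W) *m ptens M N) 0 (mxtens_index (k, l)) =
    \sum_j (adj W *m M) j l * conjc (N k j).
  rewrite mxE sum_mxtens exchange_big /=; apply: eq_bigr => j _.
  rewrite mxE mulr_suml; apply: eq_bigr => i _.
  by rewrite ptensE !adjE vecmE mulrA.
rewrite mxE sum_mxtens /mxtrace.
under eq_bigr => k _ do under eq_bigr => l _ do rewrite e vecmE mulr_suml.
under [RHS]eq_bigr => j _ do rewrite mxE.
under eq_bigr => k _ do rewrite exchange_big.
rewrite exchange_big /=; apply: eq_bigr => j _.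
rewrite exchange_big /=; apply: eq_bigr => l _.
rewrite !mxE rmorph_sum mulr_sumr; apply: eq_bigr => k _.
by rewrite rmorphM /= adjE conjcK -mulrA; congr (_ * _); rewrite mulrC.
Qed.

Lemma frob2_unitaryl m n (W : 'M[C]_m) (M : 'M[C]_(m, n)) :
  unitary W -> frob2 (W *m M) = frob2 M.
Proof. by move=> HW; rewrite /frob2 adjM -mulmxA (mulmxA (adj W)) HW mul1mx. Qed.

Lemma overlapZl n (c : R) (Phi : 'cV[C]_n) rho :
  overlap (rc c *: Phi) rho = c ^+ 2 * overlap Phi rho.
Proof.
by rewrite /overlap adjZ conjc_real -scalemxAr -!scalemxAl !mxE !ReZ mulrA.
Qed.

Lemma overlap_ptens_le d (Phi : 'cV[C]_(d * d)) (M N : 'M[C]_d) :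
  max_entangled Phi ->
  `|overlap Phi (ptens M N)| <= (frob2 M + frob2 N) / 2 / d%:R.
Proof.
move=> /max_entangledP[W HW ->].
rewrite overlapZl exprVn sqr_sqrtr ?ler0n // normrM ger0_norm ?invr_ge0 ?ler0n //.
rewrite mulrC ler_wpM2r ?invr_ge0 ?ler0n // overlap_ptens.
have HW' : unitary (adj W) by rewrite /unitary adjK; apply: unitaryC.
by rewrite -(frob2_unitaryl M HW') -(frob2_unitaryl N HW') Re_trace_conj_le.
Qed.

(** Only the final dimension [d] enters the bound. Rectangular [M] and [N] let the induction pass
    through steps that change the local dimensions. *)
Lemma locc_overlap_ptens_le d a b (L : locc R d a b) (Phi : 'cV[C]_(d * d))
    (M N : 'M[C]_(a, b)) :
  max_entangled Phi ->
  `|overlap Phi (locc_apply L (ptens M N))| <= (frob2 M + frob2 N) / 2 / d%:R.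
Proof.
move=> HPhi.
elim: L M N => [|{}a {}b a' n K HK next IH|{}a {}b b' n K HK next IH] M N /=.
- exact: overlap_ptens_le.
- rewrite overlap_sum; apply: le_trans (ler_norm_sum _ _ _) _.
  rewrite -(frob2_instrumentl M HK) -(frob2_instrumentl N HK) -big_split !mulr_suml /=.
  by apply: ler_sum => k _; rewrite kron_ptens adj1 !mulmx1.
- rewrite overlap_sum; apply: le_trans (ler_norm_sum _ _ _) _.
  rewrite -(frob2_instrumentr M HK) -(frob2_instrumentr N HK) -big_split !mulr_suml /=.
  by apply: ler_sum => k _; rewrite kron_ptens !mul1mx.
Qed.

(** * A crude bound for all pure states, and the suprema *)

Lemma frob2_coisometryr m n p (M : 'M[C]_(m, n)) (B : 'M[C]_(n, p)) :
  B *m adj B = 1%:M -> frob2 (M *m B) = frob2 M.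
Proof.
by move=> HB; rewrite /frob2 adjM mulmxA mxtrace_mulC !mulmxA HB mul1mx.
Qed.

Lemma frob2_col m n (M : 'M[C]_(m, n)) : frob2 M = \sum_j frob2 (col j M).
Proof.
rewrite frob2E exchange_big /=; apply: eq_bigr => j _.
by rewrite frob2E; apply: eq_bigr => i _; rewrite big_ord1 mxE.
Qed.

(** Expanding [M] into columns writes any pure state as a sum of partial transposes, which brings it
    within reach of the LOCC bound. *)
Lemma outer_ptens m n (M : 'M[C]_(m, n)) :
  vecm M *m adj (vecm M) =
  \sum_j \sum_l ptens (col j M *m delta_mx (0 : 'I_1) l) (col l M *m delta_mx (0 : 'I_1) j).
Proof.
apply/matrixP => r s.
case: (mxtens_indexP r) => i p; case: (mxtens_indexP s) => k q.
rewrite mxE big_ord1 adjE !vecmE summxE (bigD1 p) //= summxE (bigD1 q) //=.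
rewrite ptensE !mxE !big_ord1 !mxE !eqxx /= !mulr1.
rewrite [X in _ = _ + X + _]big1 => [|l /negPf lq]; last first.
  by rewrite ptensE !mxE !big_ord1 !mxE (eq_sym q) lq andbF mulr0 mul0r.
rewrite big1 ?addr0 // => j /negPf jp; rewrite summxE big1 // => l _.
by rewrite ptensE !mxE !big_ord1 !mxE (eq_sym p) jp andbF mulr0 rmorph0 mulr0.
Qed.

(** This serves to bound the sets whose suprema define the singlet fractions. Each of the [b ^ 2]
    column pairs contributes the mean of two squared column norms, and these means add up to [b]. *)
Lemma locc_overlap_pure_le d a b (L : locc R d a b) (Phi : 'cV[C]_(d * d))
    (v : 'cV[C]_(a * b)) :
  max_entangled Phi -> unit_vec v ->
  overlap Phi (locc_apply L (v *m adj v)) <= b%:R / d%:R.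
Proof.
have [M ->] := vecm_surj v => HPhi Hv.
have HM : frob2 M = 1 by rewrite /frob2 -vecm_dot Hv mxE.
have HB (l : 'I_b) : delta_mx (0 : 'I_1) l *m adj (delta_mx (0 : 'I_1) l) = 1%:M :> 'M[C]_1.
  rewrite adj_delta mul_delta_mx; apply/matrixP => i j.
  by rewrite !ord1 !mxE.
rewrite outer_ptens locc_overlap_sum.
have -> : b%:R / d%:R =
    \sum_(j < b) \sum_(l < b) (frob2 (col j M) + frob2 (col l M)) / 2 / d%:R.
  have -> : \sum_(j < b) \sum_(l < b) (frob2 (col j M) + frob2 (col l M)) / 2 / d%:R =
     (\sum_(j < b) \sum_(l < b) (frob2 (col j M) + frob2 (col l M))) / 2 / d%:R.
    by rewrite !mulr_suml; apply: eq_bigr => j _; rewrite !mulr_suml.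
  under eq_bigr => j _ do
    rewrite big_split /= -frob2_col HM sumr_const card_ord.
  by rewrite big_split /= sumr_const card_ord sumrMnl -frob2_col HM; congr (_ / _); lra.
apply: ler_sum => j _; rewrite locc_overlap_sum; apply: ler_sum => l _.
apply: le_trans (ler_norm _) _; apply: le_trans (locc_overlap_ptens_le _ _ _ HPhi) _.
by rewrite !frob2_coisometryr.
Qed.

Lemma max_entangled_vecm1 d : max_entangled (rc (Num.sqrt d%:R)^-1 *: vecm (1%:M : 'M[C]_d)).
Proof. by apply/max_entangledP; exists 1%:M => //; rewrite /unitary adj1 mulmx1. Qed.

Section Sup.
Local Open Scope classical_set_scope.

Lemma singlet_fraction_le d (rho : 'M[C]_(d * d)) B :
  (forall Phi, max_entangled Phi -> overlap Phi rho <= B) -> singlet_fraction rho <= B.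
Proof.
move=> H; apply: ge_sup => [|_ [Phi HPhi <-]]; last exact: H.
by eexists; eexists; first exact: max_entangled_vecm1.
Qed.

Lemma overlap_le_singlet_fraction d (rho : 'M[C]_(d * d)) B Phi :
  (forall Phi, max_entangled Phi -> overlap Phi rho <= B) ->
  max_entangled Phi -> overlap Phi rho <= singlet_fraction rho.
Proof.
move=> H HPhi; apply: ub_le_sup; last by exists Phi.
by exists B => _ [? ? <-]; exact: H.
Qed.

Lemma max_singlet_fraction_le d (rho : 'M[C]_(d * d)) B :
  (forall (L : locc R d d d) Phi, max_entangled Phi -> overlap Phi (locc_apply L rho) <= B) ->
  max_singlet_fraction rho <= B.
Proof.
move=> H; apply: ge_sup => [|_ [L _ <-]]; last exact/singlet_fraction_le/H.
by eexists; exists (LOCC_done R d).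
Qed.

Lemma singlet_fraction_le_max d (rho : 'M[C]_(d * d)) B :
  (forall (L : locc R d d d) Phi, max_entangled Phi -> overlap Phi (locc_apply L rho) <= B) ->
  singlet_fraction rho <= max_singlet_fraction rho.
Proof.
move=> H; apply: ub_le_sup; last by exists (LOCC_done R d).
by exists B => _ [L _ <-]; exact/singlet_fraction_le/H.
Qed.

(** The channel is itself a one-step instrument of Bob, so channel and protocol together form one
    protocol applied to the pure input. *)
Lemma locc_overlap_rho_out_le d k (A : 'I_k -> 'M[C]_d) (L : locc R d d d)
    (Phi psi : 'cV[C]_(d * d)) :
  \sum_i adj (A i) *m A i = 1%:M -> max_entangled Phi -> unit_vec psi ->
  overlap Phi (locc_apply L (rho_out A psi)) <= d%:R / d%:R.
Proof.
move=> HA HPhi Hpsi; rewrite /rho_out locc_apply_sum.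
exact: (locc_overlap_pure_le (LOCC_bob HA (fun=> L)) HPhi Hpsi).
Qed.

Lemma singlet_fraction_le_channel d k (A : 'I_k -> 'M[C]_d) (psi : 'cV[C]_(d * d)) :
  \sum_i adj (A i) *m A i = 1%:M -> unit_vec psi ->
  singlet_fraction (rho_out A psi) <= channel_singlet_fraction A.
Proof.
move=> HA Hpsi.
apply: le_trans (singlet_fraction_le_max (B := d%:R / d%:R) _) _ => [L Phi HPhi|].
  exact: locc_overlap_rho_out_le.
apply: ub_le_sup; last by exists psi.
exists (d%:R / d%:R) => _ [phi Hphi <-]; apply: max_singlet_fraction_le => L Phi HPhi.
exact: locc_overlap_rho_out_le.
Qed.

End Sup.

(** * Partial transposes of matrix units and their combinations *)

Lemma outer_delta m n (i k : 'I_m) (j l : 'I_n) :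
  vecm (delta_mx i j) *m adj (vecm (delta_mx k l)) =
  ptens (delta_mx i l) (delta_mx k j).
Proof.
apply/matrixP => r s.
case: (mxtens_indexP r) => p q; case: (mxtens_indexP s) => t u.
rewrite mxE big_ord1 adjE !vecmE ptensE !mxE !rmorph_nat -!natrM !mulnb.
by congr ((nat_of_bool _)%:R); rewrite andbACA [RHS]andbACA (andbC (u == l)).
Qed.

Lemma ptens_lincomb m n (a b : R) (M N : 'M[C]_(m, n)) :
  ptens (rc a *: M + rc b *: N) (rc a *: M + rc b *: N) =
  rc (a ^+ 2) *: ptens M M + rc (a * b) *: ptens M N +
  rc (a * b) *: ptens N M + rc (b ^+ 2) *: ptens N N.
Proof.
apply/matrixP => r s; rewrite !mxE.
have cD (u v : C) : conjc (rc a * u + rc b * v) = rc a * conjc u + rc b * conjc v.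
  by case: u v => [? ?] [? ?]; apply/eqP; rewrite eq_complex /=; apply/andP; split;
    apply/eqP; ring.
by rewrite !cD ?expr2 !rmorphM; ring.
Qed.

Lemma frob2D_orth m n (M N : 'M[C]_(m, n)) :
  adj M *m N = 0 -> frob2 (M + N) = frob2 M + frob2 N.
Proof.
move=> H; have H' : adj N *m M = 0.
  by rewrite -[M]adjK -adjM H; apply/matrixP => i j; rewrite adjE !mxE rmorph0.
rewrite /frob2 adjD mulmxDl !mulmxDr H H' add0r addr0 linearD /=.
exact: (raddfD (@complex.Re R : Rcomplex R -> R)).
Qed.

Lemma frob2_lincomb_delta m n (a b : R) (i k : 'I_m) (j l : 'I_n) : i != k ->
  frob2 (rc a *: delta_mx i j + rc b *: delta_mx k l) = a ^+ 2 + b ^+ 2.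
Proof.
move=> ik; rewrite frob2D_orth ?frob2Z ?frob2_delta ?mulr1 //.
by rewrite adjZ adj_delta -scalemxAl -scalemxAr mul_delta_mx_0 // !scaler0.
Qed.

(** * The Kraus operators, with [n] = d - 1 *)

Section Damping.
Variables (n : nat) (x : nat -> R).
Hypothesis x01 : forall i : 'I_n, 0 < x i.+1 < 1.

(** The diagonal of [A ord0]: the sequence [x] with its value at index 0 replaced by 1. *)
Definition damping (i : 'I_n.+1) : R := if (i : nat) == 0%N then 1 else x i.
Local Notation y := damping.
Local Notation A := (@kraus_ops R n.+1 x).

Lemma kraus_ops0 : A ord0 = \sum_i rc (y i) *: delta_mx i i.
Proof.
apply/matrixP => i j; rewrite /kraus_ops /= mxE summxE (bigD1 i) //= !mxE eqxx /=.
rewrite big1 => [|k /negPf ki]; last by rewrite !mxE eq_sym ki mulr0.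
by rewrite addr0 /y (eq_sym j); case: (i == j); case: (_ == _); rewrite ?mulr1 ?mulr0.
Qed.

Lemma kraus_opsS (m : 'I_n) :
  A (lift ord0 m) = rc (Num.sqrt (1 - x m.+1 ^+ 2)) *: delta_mx ord0 (lift ord0 m).
Proof.
apply/matrixP => i j; rewrite /kraus_ops /= !mxE -[(i : nat) == 0%N]/(i == ord0).
by case: (_ && _); rewrite ?mulr1 ?mulr0.
Qed.

Lemma rc_sqrt_sq (m : 'I_n) :
  rc (Num.sqrt (1 - x m.+1 ^+ 2)) * rc (Num.sqrt (1 - x m.+1 ^+ 2)) =
  rc (1 - x m.+1 ^+ 2).
Proof.
rewrite -rmorphM -expr2 sqr_sqrtr //; have /andP[x0 x1] := x01 m.
nra.
Qed.

Lemma kraus_ops0_adj : adj (A ord0) = A ord0.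
Proof.
rewrite kraus_ops0 adj_sum; apply: eq_bigr => i _.
by rewrite adjZ conjc_real adj_delta.
Qed.

Lemma kraus_ops0_tr : (A ord0)^T = A ord0.
Proof.
rewrite kraus_ops0 linear_sum; apply: eq_bigr => i _.
by rewrite linearZ /= trmx_delta.
Qed.

Lemma kraus_ops0_sq : A ord0 *m A ord0 = diag_mx (\row_i rc (y i ^+ 2)).
Proof.
rewrite kraus_ops0 diag_mx_sum_delta mulmx_suml; apply: eq_bigr => i _.
rewrite mulmx_sumr (bigD1 i) //= big1 => [|k ki].
  by rewrite addr0 -scalemxAl -scalemxAr mul_delta_mx scalerA mxE -rmorphM -expr2.
by rewrite -scalemxAl -scalemxAr mul_delta_mx_0 1?eq_sym // !scaler0.
Qed.

(** [A ord0] contributes the squares of the diagonal, and each later operator fills the missing 1 -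
    x_m^2 at its own diagonal place. *)
Lemma kraus_complete : \sum_m adj (A m) *m A m = 1%:M.
Proof.
rewrite big_ord_recl kraus_ops0_adj kraus_ops0_sq -diag_const_mx !diag_mx_sum_delta.
rewrite !big_ord_recl -addrA -big_split /=; congr (_ + _).
  by rewrite !mxE /y /= expr1n.
apply: eq_bigr => m _; rewrite kraus_opsS adjZ conjc_real adj_delta -scalemxAl -scalemxAr.
rewrite mul_delta_mx scalerA rc_sqrt_sq !mxE -scalerDl -rmorphD.
by rewrite /y /= addrC subrK.
Qed.

(** This is the output on the unnormalized input sum_i |ii>, since [vecm (A m)^T] is the image of
    that vector under 1 (x) A_m. *)
Lemma kraus_outer :
  \sum_m vecm (A m)^T *m adj (vecm (A m)^T) =
  \sum_i \sum_j rc (y i * y j) *: ptens (delta_mx i j) (delta_mx j i) +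
  \sum_(m < n) rc (1 - x m.+1 ^+ 2) *:
    ptens (delta_mx (lift ord0 m) ord0) (delta_mx (lift ord0 m) ord0).
Proof.
rewrite big_ord_recl; congr (_ + _).
  rewrite kraus_ops0 linear_sum /= vecm_sum adj_sum mulmx_suml; apply: eq_bigr => i _.
  rewrite mulmx_sumr; apply: eq_bigr => j _.
  rewrite !linearZ /= !trmx_delta !vecmZ adjZ conjc_real -scalemxAl -scalemxAr scalerA.
  by rewrite outer_delta -rmorphM.
apply: eq_bigr => m _; rewrite kraus_opsS linearZ /= trmx_delta vecmZ adjZ conjc_real.
by rewrite -scalemxAl -scalemxAr scalerA rc_sqrt_sq outer_delta.
Qed.

Lemma damping0 : y ord0 = 1. Proof. by []. Qed.

Lemma dampingS (m : 'I_n) : y (lift ord0 m) = x m.+1. Proof. by []. Qed.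

(* On the span of |0m> and |m0> the partially transposed state has the
   orthogonal eigenvectors (x, 1) and (1, -x), with eigenvalues 1 and -x^2. *)
Lemma locc_overlap_block_le d (L : locc R d n.+1 n.+1) (Phi : 'cV[C]_(d * d)) (m : 'I_n)
    (g := fun M N => overlap Phi (locc_apply L (ptens M N)))
    (u := delta_mx ord0 (lift ord0 m)) (v := delta_mx (lift ord0 m) ord0) :
  max_entangled Phi ->
  x m.+1 * (g u v + g v u) + (1 - x m.+1 ^+ 2) * g v v <= (1 + x m.+1 ^+ 2) / d%:R.
Proof.
move=> HPhi; set t := x m.+1.
have gE a b : g (rc a *: u + rc b *: v) (rc a *: u + rc b *: v) =
    a ^+ 2 * g u u + a * b * g u v + a * b * g v u + b ^+ 2 * g v v.
  by rewrite /g ptens_lincomb !locc_overlapD !locc_overlapZ.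
have gle a b : `|g (rc a *: u + rc b *: v) (rc a *: u + rc b *: v)|
    <= (a ^+ 2 + b ^+ 2) / d%:R.
  apply: le_trans (locc_overlap_ptens_le _ _ _ HPhi) _.
  by rewrite frob2_lincomb_delta // (_ : (_ + _) / 2 = a ^+ 2 + b ^+ 2) //; field.
(* The two eigenvectors: an upper bound is kept for (t, 1), whose eigenvalue is positive, and a
   lower bound for (1, -t), whose eigenvalue is negative. *)
have := gle t 1; have := gle 1 (- t); rewrite !gE !ler_norml => /andP[h1 _] /andP[_ h2].
have t2 : 0 < 1 + t ^+ 2 by rewrite ltr_wpDr ?sqr_ge0.
(* After scaling by 1 + t^2, the left side is the first form minus t^2 times the second; the [g u u]
   terms cancel. *)
rewrite -(ler_pM2l t2).
have := ler_wpM2l (sqr_ge0 t) h1.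
move: h2; set D := d%:R^-1; set p := g u u; set q := g u v; set r := g v u; set w := g v v.
by move=> h2 h3; nra.
Qed.

(** In units of 1/d, the |00> term gives 1, the block of each m gives 1 + x_m^2, and the entries
    with both indices positive give the square of the sum of the x_i. *)
Lemma locc_overlap_kraus_le d (L : locc R d n.+1 n.+1) (Phi : 'cV[C]_(d * d)) :
  max_entangled Phi ->
  overlap Phi (locc_apply L (\sum_m vecm (A m)^T *m adj (vecm (A m)^T))) <=
  (n.+1%:R + \sum_(m < n) x m.+1 ^+ 2 + (\sum_(m < n) x m.+1) ^+ 2) / d%:R.
Proof.
move=> HPhi; rewrite kraus_outer.
pose g M N := overlap Phi (locc_apply L (ptens M N)).
have gle i j k l : g (delta_mx i j) (delta_mx k l) <= 1 / d%:R.
  apply: le_trans (ler_norm _) _.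
  apply: le_trans (locc_overlap_ptens_le _ _ _ HPhi) _.
  by rewrite !frob2_delta (_ : (1 + 1) / 2 = 1) //; field.
rewrite locc_overlapD !locc_overlap_sum.
have -> : \sum_i overlap Phi (locc_apply L
      (\sum_j rc (y i * y j) *: ptens (delta_mx i j) (delta_mx j i))) =
    \sum_i \sum_j y i * y j * g (delta_mx i j) (delta_mx j i).
  apply: eq_bigr => i _; rewrite locc_overlap_sum; apply: eq_bigr => j _.
  by rewrite locc_overlapZ.
have -> : \sum_(m < n) overlap Phi (locc_apply L (rc (1 - x m.+1 ^+ 2) *:
      ptens (delta_mx (lift ord0 m) ord0) (delta_mx (lift ord0 m) ord0))) =
    \sum_(m < n) (1 - x m.+1 ^+ 2) *
      g (delta_mx (lift ord0 m) ord0) (delta_mx (lift ord0 m) ord0).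
  by apply: eq_bigr => m _; rewrite locc_overlapZ.
(* Row and column 0 are split off, to be regrouped with the second sum into the two-dimensional
   blocks. *)
rewrite big_ord_recl big_ord_recl.
have -> : \sum_(i < n) \sum_j y (lift ord0 i) * y j *
      g (delta_mx (lift ord0 i) j) (delta_mx j (lift ord0 i)) =
    \sum_(i < n) y (lift ord0 i) * 1 *
      g (delta_mx (lift ord0 i) ord0) (delta_mx ord0 (lift ord0 i)) +
    \sum_(i < n) \sum_(j < n) y (lift ord0 i) * y (lift ord0 j) *
      g (delta_mx (lift ord0 i) (lift ord0 j)) (delta_mx (lift ord0 j) (lift ord0 i)).
  by rewrite -big_split; apply: eq_bigr => i _; rewrite big_ord_recl.
rewrite !damping0.
set D := d%:R^-1.
have -> : (n.+1%:R + \sum_(m < n) x m.+1 ^+ 2 + (\sum_(m < n) x m.+1) ^+ 2) * D =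
   D + \sum_(m < n) (1 + x m.+1 ^+ 2) * D + \sum_(i < n) \sum_(j < n) x i.+1 * x j.+1 * D.
  rewrite expr2 big_distrlr /= -mulr_suml big_split /= sumr_const card_ord.
  have -> : \sum_(i < n) \sum_(j < n) x i.+1 * x j.+1 * D =
     (\sum_(i < n) \sum_(j < n) x i.+1 * x j.+1) * D.
    by rewrite mulr_suml; apply: eq_bigr => i _; rewrite mulr_suml.
  by rewrite -natr1; ring.
have h0 : 1 * 1 * g (delta_mx ord0 ord0) (delta_mx ord0 ord0) <= D.
  by rewrite !mul1r; have := gle ord0 ord0 ord0 ord0; rewrite mul1r.
have h1 : \sum_(i < n) \sum_(j < n) y (lift ord0 i) * y (lift ord0 j) *
     g (delta_mx (lift ord0 i) (lift ord0 j)) (delta_mx (lift ord0 j) (lift ord0 i)) <=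
   \sum_(i < n) \sum_(j < n) x i.+1 * x j.+1 * D.
  apply: ler_sum => i _; apply: ler_sum => j _; rewrite !dampingS.
  have /andP[/ltW xi _] := x01 i; have /andP[/ltW xj _] := x01 j.
  by rewrite ler_wpM2l ?mulr_ge0 // -[D]mul1r gle.
have h2 : \sum_(m < n) (1 * y (lift ord0 m) *
       g (delta_mx ord0 (lift ord0 m)) (delta_mx (lift ord0 m) ord0) +
     y (lift ord0 m) * 1 *
       g (delta_mx (lift ord0 m) ord0) (delta_mx ord0 (lift ord0 m)) +
     (1 - x m.+1 ^+ 2) *
       g (delta_mx (lift ord0 m) ord0) (delta_mx (lift ord0 m) ord0)) <=
   \sum_(m < n) (1 + x m.+1 ^+ 2) * D.
  apply: ler_sum => m _; have := locc_overlap_block_le L m HPhi.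
  by rewrite -/D !dampingS mul1r mulr1 mulrDr.
move: h2; rewrite !big_split /= => h2.
by move: h0 h1 h2; rewrite /= ; lra.
Qed.

(** * Upper bound for maximally entangled inputs *)

Lemma rho_out_vecm d k (K : 'I_k -> 'M[C]_d) c (M : 'M[C]_d) :
  rho_out K (rc c *: vecm M) =
  rc (c ^+ 2) *: \sum_i vecm (M *m (K i)^T) *m adj (vecm (M *m (K i)^T)).
Proof.
rewrite /rho_out scaler_sumr; apply: eq_bigr => i _.
rewrite adjZ conjc_real -!scalemxAl -!scalemxAr -!scalemxAl scalerA -rmorphM -expr2.
by rewrite mulmxA -(mulmxA (_ *m vecm M)) -adjM kron_vecm mul1mx.
Qed.

Lemma max_singlet_fraction_max_entangled_le (Phi : 'cV[C]_(n.+1 * n.+1)) :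
  max_entangled Phi ->
  max_singlet_fraction (rho_out A Phi) <=
  (n.+1%:R + \sum_(m < n) x m.+1 ^+ 2 + (\sum_(m < n) x m.+1) ^+ 2) / n.+1%:R ^+ 2.
Proof.
move=> /max_entangledP[W HW ->]; apply: max_singlet_fraction_le => L Psi HPsi.
(* The unitary [W] of the input acts on Alice's side and commutes with the channel, so it is
   absorbed as a one-outcome first step of the protocol. *)
have HK : \sum_(k < 1) adj W *m W = 1%:M by rewrite big_ord1.
have := locc_overlap_kraus_le (LOCC_alice HK (fun=> L)) HPsi.
rewrite /= big_ord1 rho_out_vecm locc_overlapZ.
have -> : \sum_i vecm (W *m (A i)^T) *m adj (vecm (W *m (A i)^T)) =
   kron W 1%:M *m (\sum_m vecm (A m)^T *m adj (vecm (A m)^T)) *m adj (kron W (1%:M : 'M[C]_n.+1)).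
  rewrite mulmx_sumr mulmx_suml; apply: eq_bigr => i _.
  by rewrite mulmxA -(mulmxA (_ *m vecm _)) -adjM kron_vecm trmx1 mulmx1.
rewrite exprVn sqr_sqrtr ?ler0n // => h.
by rewrite expr2 invfM mulrA mulrC ler_wpM2r // invr_ge0 ler0n.
Qed.

(** * The better input and its singlet fraction *)

Definition damping_norm2 : R := \sum_i y i ^+ 2.
Local Notation S := damping_norm2.

Lemma damping_norm2E : S = 1 + \sum_(m < n) x m.+1 ^+ 2.
Proof. by rewrite /S big_ord_recl damping0 expr1n. Qed.

Lemma damping_norm2_gt0 : 0 < S.
Proof. by rewrite damping_norm2E ltr_wpDr // sumr_ge0 // => m _; rewrite sqr_ge0. Qed.

Lemma trace_kraus_ops0_sq : \tr (A ord0 *m A ord0) = rc S.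
Proof.
rewrite kraus_ops0_sq mxtrace_diag /S rmorph_sum.
by apply: eq_bigr => i _; rewrite mxE.
Qed.

(** The Schmidt coefficients are proportional to the diagonal of [A ord0]; by Cauchy-Schwarz this
    maximizes, among diagonal inputs, the overlap of the [A ord0] branch with the standard maximally
    entangled state. *)
Definition damped_state : 'cV[C]_(n.+1 * n.+1) := rc (Num.sqrt S)^-1 *: vecm (A ord0).

Lemma unit_vec_damped_state : unit_vec damped_state.
Proof.
apply/matrixP => i j; rewrite !ord1 /damped_state adjZ conjc_real -scalemxAl -scalemxAr.
rewrite scalerA -rmorphM -expr2 exprVn sqr_sqrtr ?(ltW damping_norm2_gt0) // mxE vecm_dot.
rewrite kraus_ops0_adj trace_kraus_ops0_sq -rmorphM mulVf ?mxE //.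
by rewrite gt_eqF ?damping_norm2_gt0.
Qed.

(** Otherwise [A ord0] would be a multiple of a unitary and its squared diagonal would be constant,
    against the entries 1 and x_1^2 < 1. *)
Lemma damped_state_not_max_entangled : (0 < n)%N -> ~ max_entangled damped_state.
Proof.
move=> n0 /max_entangledP[W HW]; rewrite /damped_state -!vecmZ => /vecm_inj e.
have /matrixP E := congr1 (fun M => adj M *m M) e.
have {E} E i : (Num.sqrt S)^-1 ^+ 2 * y i ^+ 2 = (Num.sqrt n.+1%:R)^-1 ^+ 2.
  have := E i i; rewrite !adjZ !conjc_real -!scalemxAl -!scalemxAr !scalerA -!rmorphM.
  rewrite kraus_ops0_adj kraus_ops0_sq HW !mxE eqxx !mulr1n mulr1 -rmorphM -!expr2.
  exact: complexI.
have := E ord0; rewrite -(E (lift ord0 (Ordinal n0))) damping0 dampingS expr1n.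
move=> /mulfI H; have /andP[x0 x1] := x01 (Ordinal n0).
have : (1 : R) = x 1 ^+ 2.
  by apply: H; rewrite expf_neq0 // invr_neq0 // gt_eqF // sqrtr_gt0 damping_norm2_gt0.
by move: x0 x1 => /= x0 x1; nra.
Qed.

Lemma overlap_outer d (Phi v : 'cV[C]_d) :
  overlap Phi (v *m adj v) = complex.Re ((adj Phi *m v) 0 0) ^+ 2 +
    complex.Im ((adj Phi *m v) 0 0) ^+ 2.
Proof.
rewrite /overlap mulmxA -mulmxA -[X in _ *m (_ *m X)]adjK -adjM mxE big_ord1 adjE.
by case: (_ 0 0) => a b /=; ring.
Qed.

(** The test state is the normalized [vecm 1%:M]. The [A ord0] branch alone yields (tr A_0^2)^2 / (S
    d) = S / d. *)
Lemma singlet_fraction_damped_state_ge :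
  S / n.+1%:R <= singlet_fraction (rho_out A damped_state).
Proof.
have HP := @max_entangled_vecm1 n.+1.
apply: le_trans (overlap_le_singlet_fraction (B := n.+1%:R / n.+1%:R) _ HP); last first.
  move=> Phi HPhi.
  exact: (locc_overlap_rho_out_le (LOCC_done R n.+1) kraus_complete HPhi unit_vec_damped_state).
rewrite rho_out_vecm overlapZ overlap_sum big_ord_recl mulrDr.
(* The other branches contribute squared moduli and are dropped. *)
apply: (@le_trans _ _ ((Num.sqrt S)^-1 ^+ 2 * overlap (rc (Num.sqrt n.+1%:R)^-1 *: vecm 1%:M)
   (vecm (A ord0 *m (A ord0)^T) *m adj (vecm (A ord0 *m (A ord0)^T))))); last first.
  rewrite lerDl mulr_ge0 ?sqr_ge0 // sumr_ge0 // => m _.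
  by rewrite overlap_outer addr_ge0 ?sqr_ge0.
rewrite overlapZl overlap_outer vecm_dot adj1 mul1mx kraus_ops0_tr trace_kraus_ops0_sq /=.
rewrite expr0n addr0 !exprVn !sqr_sqrtr ?ler0n ?(ltW damping_norm2_gt0) //.
have S0 : S != 0 by rewrite gt_eqF // damping_norm2_gt0.
have : n.+1%:R != 0 :> R by rewrite pnatr_eq0.
move: (n.+1%:R : R) => D D0; rewrite le_eqVlt; apply/orP; left; apply/eqP.
by field; apply/andP.
Qed.

(** * Strict Cauchy-Schwarz and the conclusion *)

(** Lagrange's identity: the sum of all squared differences is twice the gap, and the pair [i0],
    [j0] makes it positive. *)
Lemma sum_sqr_lt (i0 j0 : 'I_n) : x i0.+1 != x j0.+1 ->
  (\sum_(m < n) x m.+1) ^+ 2 < n%:R * \sum_(m < n) x m.+1 ^+ 2.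
Proof.
move=> xij.
have e : \sum_(i < n) \sum_(j < n) (x i.+1 - x j.+1) ^+ 2 =
    (n%:R * (\sum_(m < n) x m.+1 ^+ 2) - (\sum_(m < n) x m.+1) ^+ 2) *+ 2.
  under eq_bigr => i _ do
    (under eq_bigr => j _ do rewrite sqrrB; rewrite !big_split /= sumr_const card_ord).
  rewrite !big_split /= sumr_const card_ord sumrMnl.
  have -> : \sum_(i < n) \sum_(j < n) - (x i.+1 * x j.+1 *+ 2) =
      - ((\sum_(m < n) x m.+1) ^+ 2 *+ 2).
    rewrite expr2 big_distrlr /= -sumrMnl -sumrN; apply: eq_bigr => i _.
    by rewrite -sumrMnl -sumrN.
  by rewrite -[(\sum_(m < n) _) *+ n]mulr_natl; ring.
suff : 0 < \sum_(i < n) \sum_(j < n) (x i.+1 - x j.+1) ^+ 2.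
  by rewrite e pmulrn_lgt0 // subr_gt0.
rewrite (bigD1 i0) //= (bigD1 j0) //= -addrA ltr_pwDl //.
  by rewrite lt_def sqr_ge0 andbT expf_neq0 // subr_eq0.
by rewrite addr_ge0 ?sumr_ge0 // => i _; rewrite ?sqr_ge0 // sumr_ge0 // => j _;
  rewrite sqr_ge0.
Qed.

End Damping.

End Bipartite.

Theorem theorem1 (R : realType) (d : nat) (x : nat -> R) :
  (3 <= d)%N ->
  (forall i : nat, (1 <= i <= d.-1)%N -> 0 < x i /\ x i < 1) ->
  (exists i j : nat, [/\ (1 <= i <= d.-1)%N, (1 <= j <= d.-1)%N & x i != x j]) ->
  exists psi' : 'cV[R[i]]_(d * d),
    unit_vec psi' /\ ~ max_entangled psi' /\
    forall Phi : 'cV[R[i]]_(d * d), max_entangled Phi ->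
      singlet_fraction (rho_out (@kraus_ops R d x) psi')
        <= channel_singlet_fraction (@kraus_ops R d x) /\
      max_singlet_fraction (rho_out (@kraus_ops R d x) Phi)
        < singlet_fraction (rho_out (@kraus_ops R d x) psi').
Proof.
case: d => // n n2 x01 [[|i] [[|j] [//= Hi Hj xij]]] //.
have {}x01 (m : 'I_n) : 0 < x m.+1 < 1 by apply/andP/x01; rewrite /= ltn_ord.
exists (damped_state n x); split; first exact: unit_vec_damped_state.
split; first by apply: damped_state_not_max_entangled => //;
  exact: (leq_trans _ (n2 : (2 <= n)%N)).
move=> Phi HPhi; split.
  by apply: singlet_fraction_le_channel; [exact: kraus_complete|exact: unit_vec_damped_state].
apply: le_lt_trans (max_singlet_fraction_max_entangled_le x01 HPhi) _.
apply: lt_le_trans (singlet_fraction_damped_state_ge x01).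
have := @sum_sqr_lt _ n x (Ordinal Hi) (Ordinal Hj) xij.
rewrite damping_norm2E; set S1 := \sum_(m < n) x m.+1; set S2 := \sum_(m < n) _ => h.
have d0 : 0 < n.+1%:R :> R by rewrite ltr0n.
(* Clearing denominators leaves d + S2 + S1^2 < d (1 + S2), which is S1^2 < n S2 as d = n + 1. *)
rewrite expr2 invfM mulrA ltr_pM2r ?invr_gt0 // ltr_pdivrMr //.
by move: h; rewrite -(@natr1 R n); nra.
Qed.
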